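(* Let $d\ge2$ be an integer. Then $$0\le h_\Delta<h_*\le h_\square<\sqrt{2u_*},$$ where $h_*$ is the critical value for level-set percolation of the Gaussian free field on the $(d+1)$-regular tree $T$ with unit weights, $u_*$ is the critical level for the percolation of the vacant set $\mathcal V^u$ of random interlacements on $T$, and $h_\Delta$ and $h_\square\ge0$ are defined by $$d\,\overline\Phi\Big(h_\Delta\,\frac{d-1}{\sqrt d}\Big)=1,\qquad \lambda_0\,e^{-\frac{h_\square^2(d-1)^2}{2d}}=1 .$$
   Context: $\overline\Phi(a)=\frac1{\sqrt{2\pi}}\int_a^{\infty}e^{-s^2/2}\,ds$. $T$ is the $(d+1)$-regular tree with unit weights; the Gaussian free field $(\varphi_x)_{x\in T}$ is the centered Gaussian field with covariance $g(x,y)=\frac1{d+1}E_x[\sum_{k\ge0}1\{Z_k=y\}]$, with $Z$ simple random walk on $T$. $\nu$ is the centered Gaussian law on $\mathbb R$ with variance $\sigma^2=\frac{d}{d^2-1}$. $L$ is the operator on $L^2(\nu)$ given by $(Lf)(a)=d\,E^Y\big[f\big(\tfrac ad+\sqrt{1-d^{-2}}\,Y\big)\big]$ with $Y$ distributed according to $\nu$. For $h\in\mathbb R$, $\pi_h$ is multiplication by $1_{[h,\infty)}$, $L_h=\pi_hL\pi_h$, and $\lambda_h=\|L_h\|_{L^2(\nu)\to L^2(\nu)}=\sup\{\langle f,L_hf\rangle_\nu:\|f\|_{L^2(\nu)}=1\}$. The map $h\mapsto\lambda_h$ is a decreasing homeomorphism of $\mathbb R$ onto $(0,d)$. The critical value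 $h_*$ is the unique real number with $\lambda_{h_*}=1$: a.s. $\{\varphi\ge h\}$ has an infinite component for $h<h_*$, and only finite components for $h>h_*$. The vacant set $\mathcal V^u$ of random interlacements at level $u>0$ on $T$ is the random subset of $T$ whose law is characterized by $\mathbb P[C\subseteq\mathcal V^u]=e^{-u\,\mathrm{cap}(C)}$ for finite $C\subseteq T$, where $\mathrm{cap}(C)=\sum_{x\in C}(d+1)P_x[Z_k\notin C\ \forall k\ge1]$. Its critical level $u_*$ for percolation is known (Teixeira) to be given by $d\,e^{-u_*\frac{(d-1)^2}{d}}=1$. *)

(* Defs.v *)
From HB Require Import structures.
From mathcomp Require Import all_boot all_order all_algebra.
From mathcomp Require Import all_classical all_reals all_analysis.

Set Implicit Arguments.
Unset Strict Implicit.
Unset Printing Implicit Defensive.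

Import Order.TTheory GRing.Theory Num.Theory.
Import numFieldNormedType.Exports.

Local Open Scope classical_set_scope.
Local Open Scope ring_scope.

Definition Phibar (R : realType) (a : R) : R :=
  (Num.sqrt (2 * pi))^-1 *
  Rintegral (@lebesgue_measure R) `[a, +oo[ (fun s => expR (- s ^+ 2 / 2)).

Definition sigma (R : realType) (d : nat) : R :=
  Num.sqrt (d%:R / (d%:R ^+ 2 - 1)).

(* The second argument of normal_prob is the standard deviation. *)
Definition nu (R : realType) (d : nat) : probability (measurableTypeR R) R :=
  normal_prob 0 (sigma R d).

Definition Lop (R : realType) (d : nat) (f : R -> R) (a : R) : R :=
  d%:R * Rintegral (nu R d) setT
    (fun y => f (a / d%:R + Num.sqrt (1 - (d%:R ^+ 2)^-1) * y)).

Definition pih (R : realType) (h : R) (f : R -> R) (a : R) : R :=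
  \1_(`[h, +oo[%classic) a * f a.

Definition Lh (R : realType) (d : nat) (h : R) (f : R -> R) : R -> R :=
  pih h (Lop d (pih h f)).

Definition norm2 (R : realType) (mu : probability (measurableTypeR R) R)
    (f : R -> R) : R :=
  fine (Lnorm mu 2%:E (EFin \o f)).

(* The supremum is over a nonempty bounded set of reals when A is
   bounded; the library's sup is 0 when there is no upper bound. *)
Definition opnorm2 (R : realType) (mu : probability (measurableTypeR R) R)
    (A : (R -> R) -> (R -> R)) : R :=
  sup [set norm2 mu (A f) | f in [set f : R -> R |
        f \in Lfun mu 2%:E /\ norm2 mu f = 1]].

Definition lambda (R : realType) (d : nat) (h : R) : R :=
  opnorm2 (nu R d) (Lh d h).

(* A locally finite graph is given by the list nb x of the neighbours of each
   vertex x. *)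
Definition adj (T : eqType) (nb : T -> seq T) : rel T := fun x y => y \in nb x.

(* Connectedness and acyclicity are expressed together: any two vertices are
   joined by exactly one self-avoiding path. *)
Definition regular_tree (T : eqType) (nb : T -> seq T) (deg : nat) : Prop :=
  [/\ inhabited T,
      forall x, uniq (nb x) /\ size (nb x) = deg,
      forall x, ~~ adj nb x x,
      symmetric (adj nb)
    & forall x y, exists! p : seq T,
        [/\ path (adj nb) x p, last x p = y & uniq (x :: p)]].

Definition component (T : eqType) (nb : T -> seq T) (A : set T) (x : T) :
    set T :=
  [set y | exists p : seq T,
    [/\ path (adj nb) x p, last x p = y & forall z, z \in x :: p -> A z]].

Definition has_infinite_component (T : eqType) (nb : T -> seq T) (A : set T) :
    Prop :=
  exists2 x, A x & infinite_set (component nb A x).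

(* P_x[Z_k = y] for the simple random walk Z, by the Markov property at
   time 1. *)
Fixpoint walk_prob (R : realType) (T : eqType) (nb : T -> seq T) (k : nat)
    (x y : T) : R :=
  if k is k'.+1
  then (\sum_(z <- nb x) walk_prob R nb k' z y) / (size (nb x))%:R
  else (x == y)%:R.

(* P_x[Z_k \notin C for all 1 <= k <= n]. *)
Fixpoint avoid_prob (R : realType) (T : eqType) (nb : T -> seq T) (C : seq T)
    (n : nat) (x : T) : R :=
  if n is n'.+1
  then (\sum_(z <- nb x | z \notin C) avoid_prob R nb C n' z) /
       (size (nb x))%:R
  else 1.

Definition escape_prob (R : realType) (T : eqType) (nb : T -> seq T)
    (C : seq T) (x : T) : R :=
  limn (fun n => avoid_prob R nb C n x).

(* The factor size (nb x) is d + 1 on the (d + 1)-regular tree. *)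
Definition green (R : realType) (T : eqType) (nb : T -> seq T) (x y : T) : R :=
  limn (series (fun k => walk_prob R nb k x y)) / (size (nb y))%:R.

Definition cap (R : realType) (T : eqType) (nb : T -> seq T) (C : seq T) : R :=
  \sum_(x <- undup C) (size (nb x))%:R * escape_prob R nb C x.

(* normal_prob 0 0 is not the Dirac mass at 0 in the library, so degenerate
   Gaussian variables are treated separately. *)
Definition centered_gaussian (R : realType) (dO : measure_display)
    (Omega : measurableType dO) (P : probability Omega R) (X : Omega -> R) :
    Prop :=
  {ae P, forall w, X w = 0} \/
  exists2 s : R, 0 < s & forall A : set (measurableTypeR R),
    measurable A -> P (X @^-1` A) = normal_prob 0 s A.

Definition gaussian_free_field (R : realType) (dO : measure_display)
    (Omega : measurableType dO) (P : probability Omega R) (T : eqType)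
    (nb : T -> seq T) (phi : T -> {RV P >-> R}) : Prop :=
  (forall (s : seq T) (c : T -> R),
     centered_gaussian P (fun w => \sum_(x <- s) c x * phi x w)) /\
  (forall x y, covariance P (phi x) (phi y) = (green R nb x y)%:E).

Definition gff_critical_value (R : realType) (dO : measure_display)
    (Omega : measurableType dO) (P : probability Omega R) (T : eqType)
    (nb : T -> seq T) (phi : T -> {RV P >-> R}) (hs : R) : Prop :=
  (forall h, h < hs ->
     {ae P, forall w, has_infinite_component nb [set x | h <= phi x w]}) /\
  (forall h, hs < h ->
     {ae P, forall w, ~ has_infinite_component nb [set x | h <= phi x w]}).

Definition interlacement_vacant_set (R : realType) (dO : measure_display)
    (Omega : measurableType dO) (P : probability Omega R) (T : eqType)
    (nb : T -> seq T) (u : R) (V : Omega -> set T) : Prop :=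
  (forall x, measurable [set w | V w x]) /\
  (forall C : seq T,
     P [set w | forall x, x \in C -> V w x] = (expR (- (u * cap R nb C)))%:E).

Definition vacant_critical_level (R : realType) (dO : measure_display)
    (Omega : measurableType dO) (P : probability Omega R) (T : eqType)
    (nb : T -> seq T) (V : R -> Omega -> set T) (us : R) : Prop :=
  [/\ 0 < us,
      forall u, 0 < u -> u < us ->
        {ae P, forall w, has_infinite_component nb (V u w)}
    & forall u, us < u ->
        {ae P, forall w, ~ has_infinite_component nb (V u w)}].

(* Main.v *)
Require Import Defs.
From HB Require Import structures.
From mathcomp Require Import all_boot all_order all_algebra.
From mathcomp Require Import all_classical all_reals all_analysis.
From mathcomp Require Import measurable_realfun ring lra.

(** All four inequalities are read off the norms [lambda h] of the operators
[L_h].  With [rho = 1/d] and [c = sqrt (1 - 1/d^2)] the operator [L] is [d]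
times the Mehler operator [f |-> E f(a rho + c Y)].  When [a] and [Y] are
independent with law [nu], the pair [(a, a rho + c Y)] has a Gaussian law that
is symmetric in its two entries ([normal_reversible]).

By this symmetry the Schur test applies ([schur_test]): if a positive weight
[w] satisfies [E (1_{>= h} w)(a rho + c Y) <= mu w(a)] for [a >= h], then the
Mehler operator cut to [[h, oo)] has norm at most [mu].  The weight [1] gives
[lambda h <= d].

- [0 <= h_Delta]: [Phibar] is decreasing and [Phibar 0 >= 1/2 >= 1/d].

- [h_Delta < h_star]: apply [L_h] to the indicator of [[h, oo)].  Its value
  at [a >= h] is [d Phibar ((h - a/d) sqrt d)], which increases with [a]; for
  [h = h_Delta] it equals [1] at [a = h] and so exceeds [1] beyond.  Hence
  [lambda h_Delta > 1 = lambda h_star] ([lambda_gt1]), and [lambda] is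
  nonincreasing.

- [h_star <= h_square]: translating functions on [[h, oo)] to [[0, oo)], with
  the square root of the Cameron-Martin density to preserve the norm,
  conjugates [L_h] to [exp (- g h^2) e L_0 e], where [g = (d-1)^2 / (2 d)] and
  [e] is the multiplication by [exp (- g h t)] ([mehler_tilt]).  For [h >= 0]
  this multiplication contracts functions on [[0, oo)], so
  [lambda h <= lambda 0 exp (- g h^2)] ([lambda_tilt_le]).  At [h = h_star]
  the left side is [1], which compares [h_star] with [h_square].

- [h_square < sqrt (2 u_star)]: the defining equations read
  [exp (- g h_square^2) = 1 / lambda 0] and [exp (- 2 g u_star) = 1 / d], so
  the claim is [lambda 0 < d].  This is the Schur test with the weight
  [K + exp x]: near the origin the cut loses a fixed fraction of the mass of
  the constant [K], while far away the Mehler operator pulls [a] down to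
  [a/d] and thereby shrinks the exponential
  ([normal_contraction_weight]). *)

Set Implicit Arguments.
Unset Strict Implicit.
Unset Printing Implicit Defensive.

Import Order.TTheory GRing.Theory Num.Theory.
Import numFieldNormedType.Exports.

Local Open Scope classical_set_scope.
Local Open Scope ring_scope.

(** * Lebesgue and Gaussian integrals *)

Lemma measurable_affine (R : realType) (b c : R) :
  measurable_fun setT (fun x : R => b + c * x).
Proof. by apply: measurable_funD => //; exact: measurable_funM. Qed.

(** Scaled by [c], the image of Lebesgue measure under [x |-> b + c x] is
again Lebesgue measure, since both agree on bounded intervals. *)
Lemma ge0_integral_affine (R : realType) (b c : R) (f : R -> \bar R) :
  0 < c -> measurable_fun setT f -> (forall x, (0 <= f x)%E) ->
  (\int[lebesgue_measure]_x f x
   = c%:E * \int[lebesgue_measure]_x f (b + c * x)%R)%E.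
Proof.
move=> c0 mf f0.
pose phi : measurableTypeR R -> measurableTypeR R := fun x => b + c * x.
have mphi : measurable_fun setT phi := measurable_affine b c.
pose C : {nonneg R} := NngNum (ltW c0).
pose m_ : {measure set (measurableTypeR R) -> \bar R} :=
  mscale C (pushforward (@lebesgue_measure R) phi).
pose m := m_ mphi.
transitivity (\int[m]_x f x)%E.
  apply: eq_measure_integral => A mA _.
  apply: lebesgue_measure_unique => //= _ [[x y] /= _ <-].
  rewrite /m /m_ /mscale/= /pushforward.
  have -> : phi @^-1` `]x, y] = `](x - b) / c, (y - b) / c]%classic.
    apply/seteqP; split => z /=; rewrite !in_itv/= /phi ltr_pdivrMr//
      ler_pdivlMr// !(ltrBlDr, lerBrDr) (addrC _ b) (mulrC z) => //.
  rewrite !lebesgue_measure_itv/= !lte_fin ltr_pM2r ?invr_gt0// ltrD2r.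
  case: ifP => _; last by rewrite mule0.
  by rewrite -!EFinB -EFinM; congr EFin; field; rewrite gt_eqF.
rewrite /m /m_ ge0_integral_mscale//=; congr (_ * _)%E.
by rewrite ge0_integral_pushforward.
Qed.

(** The Radon-Nikodym derivative of a normal law is almost everywhere its
density, by uniqueness of densities. *)
Lemma ge0_integral_normal_prob (R : realType) (m s : R) (f : R -> \bar R) :
  measurable_fun setT f -> (forall x, (0 <= f x)%E) ->
  (\int[normal_prob m s]_x f x
   = \int[lebesgue_measure]_x (f x * (normal_pdf m s x)%:E))%E.
Proof.
move=> mf f0.
have dom := normal_prob_dominates m s.
rewrite -(Radon_Nikodym_SigmaFinite.change_of_variables dom)//.
have pdfE : ae_eq lebesgue_measure setT
    (Radon_Nikodym_SigmaFinite.f (normal_prob m s) lebesgue_measure)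
    (fun x => (normal_pdf m s x)%:E).
  apply: integral_ae_eq => //.
  - exact: Radon_Nikodym_SigmaFinite.f_integrable.
  - by apply/measurableT_comp => //; exact: measurable_normal_pdf.
  - by move=> E _ mE; rewrite -Radon_Nikodym_SigmaFinite.f_integral.
apply: ge0_ae_eq_integral => //.
- apply: emeasurable_funM => //.
  by apply: measurable_int; exact: Radon_Nikodym_SigmaFinite.f_integrable.
- apply: emeasurable_funM => //.
  by apply/measurableT_comp => //; exact: measurable_normal_pdf.
- by move=> x _; rewrite mule_ge0// Radon_Nikodym_SigmaFinite.f_ge0.
- by move=> x _; rewrite mule_ge0// lee_fin normal_pdf_ge0.
- exact: ae_eqe_mul2l.
Qed.

(** The Cameron-Martin density: the density, with respect to the centered
normal law of deviation [s], of that law translated by [- m]. *)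
Definition shift_weight (R : realType) (s m y : R) : R :=
  expR (- (2 * m * y + m ^+ 2) / (2 * s ^+ 2)).

Lemma measurable_shift_weight (R : realType) (s m : R) :
  measurable_fun setT (shift_weight s m).
Proof.
apply: measurableT_comp => //; apply: measurable_funM => //.
by apply: measurableT_comp => //; apply: measurable_funD.
Qed.

Lemma ge0_integral_normal_shift (R : realType) (s m : R) (g : R -> \bar R) :
  s != 0 -> measurable_fun setT g -> (forall x, (0 <= g x)%E) ->
  (\int[normal_prob 0 s]_y g y =
   \int[normal_prob 0 s]_y (g (m + y)%R * (shift_weight s m y)%:E))%E.
Proof.
move=> s0 mg g0; rewrite !ge0_integral_normal_prob//.
- rewrite (@ge0_integral_affine _ m 1)//; last 2 first.
  + apply: emeasurable_funM => //; apply/measurableT_comp => //.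
    exact: measurable_normal_pdf.
  + by move=> x; rewrite mule_ge0// lee_fin normal_pdf_ge0.
  rewrite mul1e; apply: eq_integral => x _.
  rewrite mul1r -muleA; congr (_ * _)%E.
  rewrite -EFinM; congr EFin; rewrite !normal_pdfE// mulrCA; congr (_ * _).
  rewrite /normal_fun /shift_weight -expRD; congr expR.
  by field.
- apply: emeasurable_funM.
    by apply: (measurableT_comp mg); exact: measurable_funD.
  by apply/measurableT_comp => //; exact: measurable_shift_weight.
- by move=> x; rewrite mule_ge0// lee_fin expR_ge0.
Qed.

Lemma integral_normal_shift (R : realType) (s m : R) (g : R -> R) :
  s != 0 -> measurable_fun setT g ->
  (\int[normal_prob 0 s]_y (g y)%:E =
   \int[normal_prob 0 s]_y (g (m + y) * shift_weight s m y)%:E)%E.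
Proof.
move=> s0 mg; rewrite integralE [RHS]integralE.
have mg' : measurable_fun setT (EFin \o g) by exact/measurable_EFinP.
congr (_ - _)%E.
  rewrite (ge0_integral_normal_shift m s0)//; last exact: measurable_funepos.
  apply: eq_integral => x _; rewrite !funeposE/= -EFin_max -EFinM.
  by rewrite maxr_pMl ?expR_ge0// mul0r -EFin_max.
rewrite (ge0_integral_normal_shift m s0)//; last exact: measurable_funeneg.
apply: eq_integral => x _; rewrite !funenegE/= -!EFin_max -EFinM.
by rewrite maxr_pMl ?expR_ge0// mul0r mulNr.
Qed.

Lemma measurable_affine2 (R : realType) (rho c : R) :
  measurable_fun setT (fun z : R * R => z.1 * rho + c * z.2).
Proof.
by apply: measurable_funD; apply: measurable_funM.
Qed.

(** Substituting [t = a rho + c y] exhibits the joint density of [a] and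
[a rho + c Y]. *)
Lemma normal_joint_density (R : realType) (s rho c : R) (G : R * R -> \bar R) :
  s != 0 -> 0 < c -> measurable_fun setT G -> (forall z, (0 <= G z)%E) ->
  (\int[normal_prob 0 s]_a \int[normal_prob 0 s]_y G (a, a * rho + c * y)%R =
   c^-1%:E * \int[lebesgue_measure]_a \int[lebesgue_measure]_t
     (G (a, t) *
       (normal_pdf 0 s a * normal_pdf 0 s ((t - a * rho) / c))%:E))%E.
Proof.
move=> s0 c0 mG G0.
have mpdf : measurable_fun setT (normal_pdf 0 s).
  exact: measurable_normal_pdf.
have mGa a : measurable_fun setT (fun t => G (a, t)).
  by apply: (measurableT_comp mG); exact: pair1_measurable.
have mK : measurable_fun setT (fun z : R * R => (G z *
    (normal_pdf 0 s z.1 * normal_pdf 0 s ((z.2 - z.1 * rho) / c))%:E)%E).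
  apply: emeasurable_funM => //; apply/measurable_EFinP.
  apply: measurable_funM; first exact: measurableT_comp.
  apply: measurableT_comp => //; apply: measurable_funM => //.
  by apply: measurable_funB => //; apply: measurable_funM.
rewrite ge0_integral_normal_prob//; first last.
- by move=> a; exact: integral_ge0.
- apply: (measurable_fun_fubini_tonelli_F (m2 := normal_prob 0 s)
    (fun z : R * R => G (z.1, z.1 * rho + c * z.2))) => //.
  apply: (measurableT_comp mG); apply/measurable_fun_pair => //.
  exact: measurable_affine2.
rewrite -ge0_integralZl//; first last.
- by rewrite lee_fin invr_ge0 ltW.
- move=> a _; apply: integral_ge0 => t _.
  by rewrite mule_ge0// lee_fin mulr_ge0// normal_pdf_ge0.
- apply: (measurable_fun_fubini_tonelli_F (m2 := lebesgue_measure) _ mK) => z.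
  by rewrite mule_ge0// lee_fin mulr_ge0// normal_pdf_ge0.
apply: eq_integral => a _.
rewrite ge0_integral_normal_prob//; last first.
  by apply: (measurableT_comp (mGa a)); exact: measurable_affine.
rewrite [in RHS](@ge0_integral_affine _ (a * rho) c)//; first last.
- by move=> t; rewrite mule_ge0// lee_fin mulr_ge0// normal_pdf_ge0.
- exact: (measurableT_comp mK (pair1_measurable a)).
rewrite muleA -EFinM mulVf ?gt_eqF// mul1e.
rewrite -ge0_integralZr//; first last.
- by rewrite lee_fin normal_pdf_ge0.
- by move=> t _; rewrite mule_ge0// lee_fin normal_pdf_ge0.
- apply: emeasurable_funM; last exact/measurable_EFinP.
  by apply: (measurableT_comp (mGa a)); exact: measurable_affine.
apply: eq_integral => t _; rewrite -muleA -EFinM; congr (_ * _%:E)%E.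
rewrite mulrC; congr (_ * normal_pdf 0 s _).
by field; rewrite gt_eqF.
Qed.

(** For [rho^2 + c^2 = 1] the joint density of [a] and [a rho + c Y] is
proportional to [exp (- (a^2 - 2 rho a t + t^2) / (2 s^2 c^2))], which is
symmetric in [a] and [t]. *)
Lemma normal_reversible (R : realType) (s rho c : R) (G : R * R -> \bar R) :
  s != 0 -> 0 < c -> rho ^+ 2 + c ^+ 2 = 1 ->
  measurable_fun setT G -> (forall z, (0 <= G z)%E) ->
  (\int[normal_prob 0 s]_a \int[normal_prob 0 s]_y G (a, a * rho + c * y)%R =
   \int[normal_prob 0 s]_a \int[normal_prob 0 s]_y G (a * rho + c * y, a)%R)%E.
Proof.
move=> s0 c0 rc mG G0.
have mpdf : measurable_fun setT (normal_pdf 0 s).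
  exact: measurable_normal_pdf.
have mG' : measurable_fun setT (fun z : R * R => G (z.2, z.1)).
  by apply: (measurableT_comp mG); apply/measurable_fun_pair.
have GE := normal_joint_density rho s0 c0 mG G0.
have GE' := normal_joint_density rho s0 c0 mG' (fun=> G0 _).
rewrite {}GE [RHS]GE'; apply: (congr1 (mule _)).
pose K (z : R * R) : \bar R := (G z *
  (normal_pdf 0 s z.1 * normal_pdf 0 s ((z.2 - z.1 * rho) / c))%:E)%E.
have K0 z : (0 <= K z)%E.
  by rewrite mule_ge0// lee_fin mulr_ge0// normal_pdf_ge0.
have mK : measurable_fun setT K.
  apply: emeasurable_funM => //; apply/measurable_EFinP.
  apply: measurable_funM; first exact: measurableT_comp.
  apply: measurableT_comp => //; apply: measurable_funM => //.
  by apply: measurable_funB => //; apply: measurable_funM.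
have swapK :=
  @fubini_tonelli _ _ _ _ _ lebesgue_measure lebesgue_measure K mK K0.
apply: etrans swapK _.
apply: eq_integral => t _; apply: eq_integral => a _; congr (_ * _%:E)%E.
rewrite !normal_pdfE// mulrACA [RHS]mulrACA; congr (_ * _).
rewrite /normal_fun -!expRD !subr0; congr expR.
apply/eqP; rewrite -subr_eq0; apply/eqP.
transitivity ((rho ^+ 2 + c ^+ 2 - 1) *
    ((t ^+ 2 - a ^+ 2) / (c ^+ 2 * (s ^+ 2 *+ 2)))).
  by rewrite /=; field; rewrite s0 gt_eqF.
by rewrite rc subrr mul0r.
Qed.

(** * Square norms and operator norms *)

Definition sqnorm d (T : measurableType d) (R : realType)
    (mu : {measure set T -> \bar R}) (f : T -> R) : \bar R :=
  (\int[mu]_x (f x ^+ 2)%:E)%E.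

Section sqnorm.
Context d (T : measurableType d) (R : realType).
Variable mu : {measure set T -> \bar R}.
Implicit Types f g : T -> R.

Lemma sqnorm_ge0 f : (0 <= sqnorm mu f)%E.
Proof. by apply: integral_ge0 => x _; rewrite lee_fin sqr_ge0. Qed.

Lemma Lnorm2E f : Lnorm mu 2%:E (EFin \o f) = (sqnorm mu f `^ 2^-1)%E.
Proof.
rewrite unlock; congr (_ `^ _)%E; apply: eq_integral => x _ /=.
by rewrite powR_mulrn// real_normK// num_real.
Qed.

Lemma Lnorm2M f :
  (Lnorm mu 2%:E (EFin \o f) * Lnorm mu 2%:E (EFin \o f) = sqnorm mu f)%E.
Proof.
rewrite Lnorm2E; have := sqnorm_ge0 f; case: (sqnorm mu f) => [r| |]//=.
- by rewrite lee_fin => r0; rewrite powR12_sqrt// -EFinM -expr2 sqr_sqrtr.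
- by rewrite ifF ?gt_eqF ?invr_gt0// mulyy.
Qed.

Lemma sqnorm_scale f (k : R) : measurable_fun setT f ->
  sqnorm mu (fun x => k * f x) = ((k ^+ 2)%:E * sqnorm mu f)%E.
Proof.
move=> mf; rewrite /sqnorm -ge0_integralZl//.
- by apply: eq_integral => x _; rewrite exprMn EFinM.
- by apply/measurable_EFinP; exact: measurable_funX.
- by move=> x _; rewrite lee_fin sqr_ge0.
- by rewrite lee_fin sqr_ge0.
Qed.

Lemma cauchy_schwarz_Rintegral f g :
  measurable_fun setT f -> measurable_fun setT g ->
  ((Rintegral mu setT (fun x => (f x * g x)%R) ^+ 2)%:E
    <= sqnorm mu f * sqnorm mu g)%E.
Proof.
move=> mf mg.
have half : (2^-1 + 2^-1 = 1 :> R)%R by field.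
have := @hoelder _ _ _ mu f g 2 2 mf mg (ltr0Sn _ 1) (ltr0Sn _ 1) half.
set N := (Lnorm mu 1 _)%E => hN.
have IN : (`|Rintegral mu setT (fun x => f x * g x)%R|%:E <= N)%E.
  rewrite /N Lnorm1.
  apply: le_trans; last first.
    apply: le_abse_integral => //; apply/measurable_EFinP.
    exact: measurable_funM.
  rewrite /Rintegral; case: (\int[mu]_x _)%E => [r| |] /=;
    by rewrite ?normr0 ?leey.
rewrite -(Lnorm2M f) -(Lnorm2M g) muleACA -real_normK ?num_real// expr2 EFinM.
by apply: lee_pmul; rewrite ?lee_fin//; apply: (le_trans IN).
Qed.

End sqnorm.

Section opnorm2.
Context (R : realType) (mu : probability (measurableTypeR R) R).
Implicit Types (f : R -> R) (A : (R -> R) -> (R -> R)).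

Lemma norm2E f : norm2 mu f = Num.sqrt (fine (sqnorm mu f)).
Proof.
by rewrite /norm2 Lnorm2E fine_poweR powR12_sqrt// fine_ge0// sqnorm_ge0.
Qed.

Lemma Lfun2P f : (f \in Lfun mu 2%:E) <->
  measurable_fun setT f /\ (sqnorm mu f < +oo)%E.
Proof.
have NE : (Lnorm mu 2%:E (EFin \o f) < +oo)%E = (sqnorm mu f < +oo)%E.
  rewrite Lnorm2E; have := sqnorm_ge0 mu f; case: (sqnorm mu f) => [r| |]//=.
    by rewrite !ltry.
  by rewrite ifF ?gt_eqF ?invr_gt0.
split=> [|[mf ff]].
  by case/andP; rewrite !inE/= /finite_norm NE.
by apply/andP; rewrite !inE/= /finite_norm NE.
Qed.

Lemma norm2_le f C : 0 <= C ->
  (sqnorm mu f <= (C ^+ 2)%:E)%E -> norm2 mu f <= C.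
Proof.
move=> C0 fC; rewrite norm2E -(ger0_norm C0) -sqrtr_sqr ler_wsqrtr//.
rewrite -lee_fin fineK// ge0_fin_numE ?sqnorm_ge0//.
by rewrite (le_lt_trans fC)// ltry.
Qed.

Lemma sqnorm_norm2 f : (sqnorm mu f < +oo)%E ->
  sqnorm mu f = (norm2 mu f ^+ 2)%:E.
Proof.
move=> ff; rewrite norm2E sqr_sqrtr ?fine_ge0 ?sqnorm_ge0// fineK//.
by rewrite ge0_fin_numE ?sqnorm_ge0.
Qed.

Lemma norm2_ge0 f : 0 <= norm2 mu f.
Proof. by rewrite norm2E sqrtr_ge0. Qed.

(** The bound is on integrals of squares in the extended reals: no root is
taken, and the finiteness of the norm of [A f] is part of the conclusion. *)
Definition sqnorm_bound A (C : R) := forall f, measurable_fun setT f ->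
  (sqnorm mu f < +oo)%E -> (sqnorm mu (A f) <= (C ^+ 2)%:E * sqnorm mu f)%E.

Lemma opnorm2_le A C : 0 <= C -> sqnorm_bound A C -> opnorm2 mu A <= C.
Proof.
move=> C0 AC; rewrite /opnorm2; set S := (X in sup X).
have [->|/set0P S0] := eqVneq S set0; first by rewrite sup0.
apply: ge_sup => // _ [f [/Lfun2P[mf ff] f1] <-].
apply: norm2_le => //; rewrite (le_trans (AC _ mf ff))//.
by rewrite (sqnorm_norm2 ff) f1 expr1n mule1.
Qed.

(** The set whose supremum is [opnorm2 mu A] consists of the values at unit
vectors only: positive homogeneity passes from these to all [f], and an a
priori bound [C] is needed because the supremum of an unbounded set of reals
is [0] by convention. *)
Lemma norm2_le_opnorm2 A C f : 0 <= C -> sqnorm_bound A C ->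
  (forall (k : R) (g : R -> R), 0 < k -> measurable_fun setT g ->
     A (fun x => k * g x) = (fun x => k * A g x)) ->
  measurable_fun setT f -> measurable_fun setT (A f) ->
  (sqnorm mu f < +oo)%E -> norm2 mu (A f) <= opnorm2 mu A * norm2 mu f.
Proof.
move=> C0 AC AZ mf mAf ff.
have Aff : (sqnorm mu (A f) < +oo)%E.
  by rewrite (le_lt_trans (AC _ mf ff))// (sqnorm_norm2 ff) -EFinM ltry.
have := norm2_ge0 f; rewrite le_eqVlt => /predU1P[f0|f0].
  rewrite -f0 mulr0 norm2_le// expr0n/=.
  by rewrite (le_trans (AC _ mf ff))// (sqnorm_norm2 ff) -f0 expr0n mule0.
pose k := (norm2 mu f)^-1.
have k0 : 0 < k by rewrite invr_gt0.
have sqk g : measurable_fun setT g -> (sqnorm mu g < +oo)%E ->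
    norm2 mu (fun x => k * g x) = k * norm2 mu g.
  move=> mg gf; rewrite !norm2E sqnorm_scale// fineM//; last first.
    by rewrite ge0_fin_numE ?sqnorm_ge0.
  by rewrite sqrtrM ?sqr_ge0// sqrtr_sqr gtr0_norm.
rewrite -ler_pdivrMr// mulrC -/k -sqk// -AZ//.
apply: ub_le_sup.
  exists C => _ [g [/Lfun2P[mg gf] g1] <-]; apply: norm2_le => //.
  by rewrite (le_trans (AC _ mg gf))// (sqnorm_norm2 gf) g1 expr1n mule1.
exists (fun x => k * f x) => //; split; last by rewrite sqk// mulVf// gt_eqF.
apply/Lfun2P; split; first exact: measurable_funM.
by rewrite sqnorm_scale// (sqnorm_norm2 ff) -EFinM ltry.
Qed.

Lemma sqnorm_le_opnorm2 A C : 0 <= C -> sqnorm_bound A C ->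
  (forall (k : R) (g : R -> R), 0 < k -> measurable_fun setT g ->
     A (fun x => k * g x) = (fun x => k * A g x)) ->
  (forall f, measurable_fun setT f -> measurable_fun setT (A f)) ->
  sqnorm_bound A (opnorm2 mu A).
Proof.
move=> C0 AC AZ mA f mf ff.
have Aff : (sqnorm mu (A f) < +oo)%E.
  by rewrite (le_lt_trans (AC _ mf ff))// (sqnorm_norm2 ff) -EFinM ltry.
rewrite (sqnorm_norm2 ff) (sqnorm_norm2 Aff) -EFinM lee_fin -exprMn.
have := norm2_le_opnorm2 C0 AC AZ mf (mA _ mf) ff.
by move=> h; rewrite lerXn2r ?nnegrE ?norm2_ge0 ?h// (le_trans (norm2_ge0 _) h).
Qed.
End opnorm2.

(** * The Mehler operator and the Schur test *)

Lemma indic_geE (R : realType) (h a : R) :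
  \1_(`[h, +oo[%classic) a = (h <= a)%R%:R :> R.
Proof.
rewrite indicE; congr (_%:R); congr nat_of_bool.
by apply/idP/idP; rewrite inE/= in_itv/= andbT.
Qed.

Lemma pihE (R : realType) (h : R) (f : R -> R) (a : R) :
  pih h f a = if h <= a then f a else 0.
Proof. by rewrite /pih indic_geE; case: ifP => _; rewrite ?mul1r ?mul0r. Qed.

Lemma measurable_pih (R : realType) (h : R) (f : R -> R) :
  measurable_fun setT f -> measurable_fun setT (pih h f).
Proof. by move=> mf; apply: measurable_funM. Qed.

Lemma pih_ge0 (R : realType) (h : R) (f : R -> R) (a : R) :
  (forall x, 0 <= f x) -> 0 <= pih h f a.
Proof. by move=> f0; rewrite pihE; case: ifP. Qed.

Lemma sqnorm_pih_le (R : realType)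
    (mu : {measure set (measurableTypeR R) -> \bar R}) (h : R) (f : R -> R) :
  measurable_fun setT f ->
  (sqnorm mu (pih h f) <= sqnorm mu f)%E.
Proof.
move=> mf; apply: ge0_le_integral => //.
- by move=> x _; rewrite lee_fin sqr_ge0.
- by apply/measurable_EFinP; apply: measurable_funX; exact: measurable_pih.
- by apply/measurable_EFinP; exact: measurable_funX.
- by move=> x _; rewrite lee_fin pihE; case: ifP => _; rewrite ?expr0n ?sqr_ge0.
Qed.

(** When the integral is infinite, both sides are the real part of an
infinity, that is [0]. *)
Lemma RintegralZl_gt0 d (T : measurableType d) (R : realType)
    (mu : {measure set T -> \bar R}) (k : R) (f : T -> R) :
  0 < k -> measurable_fun setT f ->
  Rintegral mu setT (fun x => k * f x) = k * Rintegral mu setT f.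
Proof.
move=> k0 mf; rewrite /Rintegral integralE [in RHS]integralE.
have mf' : measurable_fun setT (EFin \o f) by exact/measurable_EFinP.
have -> : (\int[mu]_x ((fun x => (k * f x)%:E)^\+ x) =
           k%:E * \int[mu]_x ((EFin \o f)^\+ x))%E.
  rewrite -ge0_integralZl//;
    [|exact: measurable_funepos|by rewrite lee_fin ltW].
  apply: eq_integral => x _; rewrite !funeposE/= -!EFin_max -EFinM.
  by rewrite maxr_pMr ?ltW// mulr0.
have -> : (\int[mu]_x ((fun x => (k * f x)%:E)^\- x) =
           k%:E * \int[mu]_x ((EFin \o f)^\- x))%E.
  rewrite -ge0_integralZl//;
    [|exact: measurable_funeneg|by rewrite lee_fin ltW].
  apply: eq_integral => x _; rewrite !funenegE/= -!EFin_max -EFinM.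
  by rewrite maxr_pMr ?ltW// mulr0 mulrN.
have : (0 <= \int[mu]_x ((EFin \o f)^\+ x))%E by exact: integral_ge0.
have : (0 <= \int[mu]_x ((EFin \o f)^\- x))%E by exact: integral_ge0.
rewrite -[X in _ = k * fine (X - _)%E]/(\int[mu]_x ((EFin \o f)^\+ x))%E.
rewrite -[X in _ = k * fine (_ - X)%E]/(\int[mu]_x ((EFin \o f)^\- x))%E.
case: (\int[mu]_x ((EFin \o f)^\+ x))%E => [r| |]//;
  case: (\int[mu]_x ((EFin \o f)^\- x))%E => [r'| |]//= _ _;
  by rewrite ?gt0_muley ?lte_fin//= ?mulr0// mulrBr.
Qed.

Section mehler_operator.
Context (R : realType) (s rho c : R).
Hypotheses (s0 : s != 0) (c0 : 0 < c) (rc : rho ^+ 2 + c ^+ 2 = 1).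
Local Notation gam := (normal_prob 0 s).

Definition mehler (f : R -> R) (a : R) : R :=
  Rintegral gam setT (fun y => f (a * rho + c * y)).

Lemma measurable_mehler (f : R -> R) :
  measurable_fun setT f -> measurable_fun setT (mehler f).
Proof.
move=> mf; rewrite /mehler /Rintegral.
apply: (measurableT_comp (fine_measurable measurableT)).
pose F (z : R * R) := (f (z.1 * rho + c * z.2))%:E.
have mF : measurable_fun setT F.
  apply/measurable_EFinP; apply: (measurableT_comp mf).
  exact: measurable_affine2.
rewrite (_ : (fun _ => _) =
    (fun a => \int[gam]_y (F^\+ (a, y)) - \int[gam]_y (F^\- (a, y)))%E).
  apply: emeasurable_funB.
  - apply: (measurable_fun_fubini_tonelli_F (m2 := gam) (F^\+)%E) => //.
    exact: measurable_funepos.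
  - apply: (measurable_fun_fubini_tonelli_F (m2 := gam) (F^\-)%E) => //.
    exact: measurable_funeneg.
apply/funext => a; rewrite integralE.
congr (_ - _)%E; apply: eq_integral => y _.
  by rewrite !funeposE.
by rewrite !funenegE.
Qed.

Lemma mehlerZ (k : R) (f : R -> R) : 0 < k -> measurable_fun setT f ->
  mehler (fun x => k * f x) = (fun x => k * mehler f x).
Proof.
move=> k0 mf; apply/funext => a; rewrite /mehler RintegralZl_gt0//.
by apply: (measurableT_comp mf); exact: measurable_affine.
Qed.

(** By Cauchy-Schwarz applied to [f = (f / sqrt w) sqrt w], the square of
[E f(a rho + c Y)] is at most [mu w(a) E (f^2 / w)(a rho + c Y)].  Integrating
in [a] and exchanging the two points by reversibility leaves
[mu (f^2 / w) E w(a rho + c Y) <= mu^2 f^2]. *)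
Lemma schur_test (h : R) (w : R -> R) (mu : R) :
  measurable_fun setT w -> (forall x, 0 < w x) -> 0 <= mu ->
  (forall a, h <= a ->
     (\int[gam]_y (pih h w (a * rho + c * y))%:E <= (mu * w a)%:E)%E) ->
  forall f : R -> R, measurable_fun setT f ->
  (sqnorm gam (pih h (mehler (pih h f))) <= (mu ^+ 2)%:E * sqnorm gam f)%E.
Proof.
move=> mw w0 mu0 hw f mf.
set fh := pih h f.
have mfh : measurable_fun setT fh by exact: measurable_pih.
have mwh : measurable_fun setT (pih h w) by exact: measurable_pih.
have mwV : measurable_fun setT (fun x => (w x)^-1).
  rewrite (_ : (fun _ => _) = (fun x => w x `^ (-1))).
    exact: (measurableT_comp (measurable_powR _) mw).
  by apply/funext => x; rewrite powR_inv1// ltW.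
have msw : measurable_fun setT (fun x => Num.sqrt (w x)).
  rewrite (_ : (fun _ => _) = (fun x => w x `^ 2^-1)).
    exact: (measurableT_comp (measurable_powR _) mw).
  by apply/funext => x; rewrite powR12_sqrt// ltW.
have mq : measurable_fun setT (fun x => fh x / Num.sqrt (w x)).
  apply: measurable_funM => //.
  rewrite (_ : (fun _ => _) = (fun x => Num.sqrt (w x) `^ (-1))).
    exact: (measurableT_comp (measurable_powR _) msw).
  by apply/funext => x; rewrite powR_inv1.
have ma a : measurable_fun setT (fun y : R => a * rho + c * y).
  exact: measurable_affine.
pose g x := fh x ^+ 2 / w x.
have g0 x : 0 <= g x by rewrite divr_ge0 ?sqr_ge0// ltW.
have mg : measurable_fun setT g.
  by apply: measurable_funM => //; exact: measurable_funX.
(* [K (a, t)] is the integrand of the Cauchy-Schwarz bound before the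
   exchange of [a] and [t]. *)
pose K (z : R * R) := (mu * pih h w z.1 * g z.2)%:E.
have K0 z : (0 <= K z)%E.
  rewrite lee_fin mulr_ge0//; apply: mulr_ge0 => //.
  by apply: pih_ge0 => x; exact: ltW.
have mK : measurable_fun setT K.
  apply/measurable_EFinP; apply: measurable_funM.
    by apply: measurable_funM => //; exact: measurableT_comp.
  exact: measurableT_comp.
have pw a : ((pih h (mehler fh) a ^+ 2)%:E <=
    \int[gam]_y K (a, a * rho + c * y)%R)%E.
  rewrite pihE; case: ifPn => [ha|_]; last by rewrite expr0n/= integral_ge0.
  pose u y := fh (a * rho + c * y) / Num.sqrt (w (a * rho + c * y)).
  pose v y := pih h (Num.sqrt \o w) (a * rho + c * y).
  have -> : mehler fh a = Rintegral gam setT (fun y => u y * v y).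
    apply: eq_Rintegral => y _; rewrite /u /v /fh !pihE.
    by case: ifP => _; rewrite ?mul0r//= divfK// gt_eqF// sqrtr_gt0.
  apply: le_trans (cauchy_schwarz_Rintegral _ _ _) _.
  - exact: (measurableT_comp mq (ma a)).
  - exact: (measurableT_comp (measurable_pih h msw) (ma a)).
  have -> : sqnorm gam u = (\int[gam]_y (g (a * rho + c * y))%:E)%E.
    apply: eq_integral => y _; rewrite /u expr_div_n sqr_sqrtr//.
    exact: ltW.
  have -> : sqnorm gam v = (\int[gam]_y (pih h w (a * rho + c * y))%:E)%E.
    apply: eq_integral => y _; rewrite /v !pihE; case: ifP => _.
      by rewrite /= sqr_sqrtr// ltW.
    by rewrite expr0n.
  rewrite [leRHS](_ : _ =
      \int[gam]_y (g (a * rho + c * y))%:E * (mu * w a)%:E)%E.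
    apply: lee_wpmul2l; last exact: hw.
    by apply: integral_ge0 => y _; rewrite lee_fin.
  rewrite muleC -ge0_integralZl//.
  - by apply: eq_integral => y _; rewrite /K/= pihE ha -EFinM.
  - by apply/measurable_EFinP; exact: (measurableT_comp mg (ma a)).
  - by move=> y _; rewrite lee_fin.
  - by rewrite lee_fin mulr_ge0// ltW.
apply: le_trans (_ : _ <= \int[gam]_a \int[gam]_y K (a, a * rho + c * y)%R)%E _.
  apply: ge0_le_integral => //.
  - by move=> x _; rewrite lee_fin sqr_ge0.
  - apply/measurable_EFinP; apply: measurable_funX; apply: measurable_pih.
    exact: measurable_mehler.
  - apply: (measurable_fun_fubini_tonelli_F (m2 := gam)
      (fun z : R * R => K (z.1, z.1 * rho + c * z.2))) => //.
    apply: (measurableT_comp mK); apply/measurable_fun_pair => //.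
    exact: measurable_affine2.
rewrite normal_reversible//.
apply: le_trans (_ : _ <= \int[gam]_a ((mu ^+ 2)%:E * (fh a ^+ 2)%:E))%E _.
  apply: ge0_le_integral => //.
  - by move=> a _; exact: integral_ge0.
  - apply: (measurable_fun_fubini_tonelli_F (m2 := gam)
      (fun z : R * R => K (z.1 * rho + c * z.2, z.1))) => //.
    apply: (measurableT_comp mK); apply/measurable_fun_pair => //.
    exact: measurable_affine2.
  - apply: emeasurable_funM => //; apply/measurable_EFinP.
    exact: measurable_funX.
  move=> a _.
  rewrite [leLHS](_ : _ = (mu * g a)%:E *
      \int[gam]_y (pih h w (a * rho + c * y))%:E)%E; last first.
    rewrite -ge0_integralZl//.
    - by apply: eq_integral => y _; rewrite /K/= -EFinM mulrAC.
    - by apply/measurable_EFinP; exact: (measurableT_comp mwh (ma a)).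
    - by move=> y _; rewrite lee_fin pih_ge0// => x; exact: ltW.
    - by rewrite lee_fin mulr_ge0.
  have [ha|ha] := leP h a; last first.
    rewrite /g /fh !pihE !(lt_geF ha)/= expr0n/= mul0r mulr0 mul0e.
    by rewrite mule0.
  apply: le_trans (lee_wpmul2l _ (hw _ ha)) _.
    by rewrite lee_fin mulr_ge0.
  by rewrite -!EFinM lee_fin /g mulrACA -expr2 divfK// gt_eqF.
rewrite ge0_integralZl//.
- by apply: lee_wpmul2l; [rewrite lee_fin sqr_ge0|exact: sqnorm_pih_le].
- by apply/measurable_EFinP; exact: measurable_funX.
- by move=> x _; rewrite lee_fin sqr_ge0.
- by rewrite lee_fin sqr_ge0.
Qed.
End mehler_operator.

(** * Gaussian tails and exponential moments *)

(** A set of measure zero for the normal law would make the positive density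
vanish almost everywhere on it. *)
Lemma normal_prob_gt0 (R : realType) (m s : R) (A : set (measurableTypeR R)) :
  s != 0 -> measurable A -> (0 < lebesgue_measure A)%E ->
  (0 < normal_prob m s A)%E.
Proof.
move=> s0 mA A0; rewrite lt0e measure_ge0 andbT; apply/eqP => nA0.
have mp : measurable_fun A (fun x => (normal_pdf m s x)%:E).
  by apply/measurable_EFinP/measurable_funTS; exact: measurable_normal_pdf.
have pdf0 x : 0 < normal_pdf m s x.
  by rewrite normal_pdfE// mulr_gt0 ?normal_peak_gt0// expR_gt0.
have /(ae_eq_integral_abs lebesgue_measure mA mp) :
    (\int[lebesgue_measure]_(x in A) `|(normal_pdf m s x)%:E| = 0)%E.
  rewrite -nA0; apply: eq_integral => x _.
  by rewrite gee0_abs// lee_fin ltW.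
move=> [N [mN N0 AN]]; move: A0; rewrite lt_neqAle => /andP[/eqP + _]; apply.
apply/esym/(subset_measure0 (mu := lebesgue_measure) mA mN _ N0) => x Ax.
apply: AN => /= /(_ Ax) [] px0.
by have := pdf0 x; rewrite px0 ltxx.
Qed.

Lemma normal_prob_tail (R : realType) (s x : R) : 0 < s ->
  normal_prob 0 s `[x, +oo[ = (Phibar (x / s))%:E.
Proof.
move=> s0.
pose K : R := (Num.sqrt (2 * pi))^-1.
have K0 : 0 < K by rewrite invr_gt0 sqrtr_gt0 mulr_gt0// pi_gt0.
pose I := (\int[lebesgue_measure]_(t in `[(x / s)%R, +oo[)
  (expR (- t ^+ 2 / 2))%:E)%E.
have mE : measurable_fun setT (fun t : R => expR (- t ^+ 2 / 2)).
  apply: measurableT_comp => //; apply: measurable_funM => //.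
  by apply: measurableT_comp => //; exact: measurable_funX.
have mpdf : measurable_fun setT (fun t => (normal_pdf 0 s t)%:E).
  by apply/measurable_EFinP; exact: measurable_normal_pdf.
have nI : normal_prob 0 s `[x, +oo[ = (K%:E * I)%E.
  pose F := (fun t => (normal_pdf 0 s t)%:E) \_ (`[x, +oo[%classic : set R).
  have F0 t : (0 <= F t)%E.
    by rewrite /F /patch; case: ifP => // _; rewrite lee_fin normal_pdf_ge0.
  have mF : measurable_fun setT F.
    apply: (proj1 (measurable_restrictT _ _)); first exact: measurable_itv.
    exact: measurable_funTS.
  pose E := (fun t => (expR (- t ^+ 2 / 2))%:E) \_
    (`[x / s, +oo[%classic : set R).
  have E0 t : (0 <= E t)%E.
    by rewrite /E /patch; case: ifP => // _; rewrite lee_fin expR_ge0.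
  have mE' : measurable_fun setT E.
    apply: (proj1 (measurable_restrictT _ _)); first exact: measurable_itv.
    exact/measurable_funTS/measurable_EFinP.
  rewrite /normal_prob integral_mkcond -/F (ge0_integral_affine 0 s0)//.
  have mFs : measurable_fun setT (fun t => F (0 + s * t)).
    exact: (measurableT_comp mF (measurable_affine _ _)).
  rewrite -ge0_integralZl// ?lee_fin 1?ltW// /I [in RHS]integral_mkcond -/E.
  rewrite -ge0_integralZl// ?lee_fin 1?ltW//.
  apply: eq_integral => t _.
  rewrite /F /E /patch !mem_setE !in_itv/= !andbT add0r.
  rewrite ler_pdivrMr// (mulrC t); case: ifP => _; last by rewrite !mule0.
  rewrite -!EFinM; congr EFin.
  rewrite normal_pdfE ?gt_eqF// mulrA; congr (_ * _).
    rewrite /normal_peak /K -mulrnAr sqrtrM ?sqr_ge0// sqrtr_sqr gtr0_norm//.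
    by rewrite invfM mulrA divff ?gt_eqF// mul1r mulr_natl.
  rewrite /normal_fun; congr expR; field.
  by rewrite gt_eqF.
have I0 : (0 <= I)%E by apply: integral_ge0 => t _; rewrite lee_fin expR_ge0.
have : normal_prob 0 s `[x, +oo[ \is a fin_num.
  exact: (fin_num_measure (normal_prob 0 s)).
rewrite /Phibar -/K /Rintegral -/I nI.
move: I0; case: I {nI} => [r| |]// _.
by rewrite gt0_muley ?lte_fin.
Qed.

Lemma Phibar_tail (R : realType) (x : R) :
  (Phibar x)%:E = normal_prob 0 1 `[x, +oo[.
Proof. by rewrite normal_prob_tail// divr1. Qed.

Lemma Phibar_decr (R : realType) (x y : R) : x < y -> Phibar y < Phibar x.
Proof.
move=> xy; rewrite -lte_fin !Phibar_tail.
have -> : `[x, +oo[%classic = `[x, y[ `|` `[y, +oo[ :> set R.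
  apply/seteqP; split => z /=; rewrite !in_itv/= ?andbT.
    by move=> xz; case: (ltP z y) => ?; [left|right]; rewrite ?xz.
  by case=> [/andP[]//|]; apply: le_trans; exact: ltW.
rewrite measureU//=; last first.
  apply/seteqP; split => z //=; rewrite !in_itv/= ?andbT => -[/andP[_ zy]].
  by rewrite leNgt zy.
rewrite lteDr//; last exact: (fin_num_measure (normal_prob 0 1)).
apply: normal_prob_gt0 => //.
by rewrite lebesgue_measure_itv/= lte_fin xy -EFinB lte_fin subr_gt0.
Qed.

(** The two half-lines at [0] have equal mass by symmetry and cover the
line. *)
Lemma Phibar0 (R : realType) : 2^-1 <= Phibar (0 : R).
Proof.
pose P : {measure set (measurableTypeR R) -> \bar R} := normal_prob 0 1.
have sym : P `]-oo, 0]%classic = P `[0, +oo[%classic.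
  have mpdf : measurable_fun setT (fun x : R => (normal_pdf 0 1 x)%:E).
    by apply/measurable_EFinP; exact: measurable_normal_pdf.
  have pdf0 (x : R) : (0 <= (normal_pdf 0 1 x)%:E)%E.
    by rewrite lee_fin normal_pdf_ge0.
  apply: etrans (esym (ge0_integration_by_substitution0 mpdf pdf0)).
  apply: eq_integral => x _; congr EFin; rewrite !normal_pdfE ?oner_neq0//.
  by rewrite /normal_fun !subr0 sqrrN.
have : (P setT <= P `]-oo, 0%R]%classic + P `[0%R, +oo[%classic)%E.
  have -> : [set: R] = `]-oo, 0]%classic `|` `[0, +oo[%classic.
    apply/seteqP; split => // x _ /=; rewrite !in_itv/= andbT.
    by apply/orP; exact: le_total.
  exact: measureU2.
rewrite sym /P/= -Phibar_tail (probability_setT (normal_prob 0 1)).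
by rewrite -EFinD lee_fin; lra.
Qed.

(** This is the Cameron-Martin formula for the constant [1] and the shift
[- e s^2]. *)
Lemma normal_mgf (R : realType) (s e : R) : s != 0 ->
  (\int[normal_prob 0 s]_y (expR (e * y))%:E =
   (expR (e ^+ 2 * s ^+ 2 / 2))%:E)%E.
Proof.
move=> s0.
have P1 : (\int[normal_prob 0 s]_y cst 1%E y = 1)%E.
  by rewrite integral_cst// mul1e; exact: (probability_setT (normal_prob 0 s)).
have := @ge0_integral_normal_shift R s (- (e * s ^+ 2)) (cst 1%E) s0
  (measurable_cst _) (fun=> lee01).
rewrite P1 => h.
rewrite -[RHS]mule1 h -ge0_integralZl//.
- apply: eq_integral => y _; rewrite mul1e -EFinM -expRD; congr (expR _)%:E.
  by field.
- apply: emeasurable_funM => //; apply/measurable_EFinP.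
  exact: measurable_shift_weight.
- by move=> y _; rewrite mul1e lee_fin expR_ge0.
Qed.

Lemma Phibar_le1 (R : realType) (x : R) : Phibar x <= 1.
Proof.
by rewrite -lee_fin Phibar_tail; apply: (probability_le1 (normal_prob 0 1)).
Qed.

Lemma Phibar_lt1 (R : realType) (x : R) : Phibar x < 1.
Proof. by apply: lt_le_trans (Phibar_le1 (x - 1)); apply: Phibar_decr; lra. Qed.

Lemma Phibar_gt0 (R : realType) (x : R) : 0 < Phibar x.
Proof.
apply: le_lt_trans (Phibar_decr (_ : x < x + 1)); last lra.
by rewrite -lee_fin Phibar_tail; apply: (measure_ge0 (normal_prob 0 1)).
Qed.

Lemma Phibar_nincr (R : realType) (x y : R) : x <= y -> Phibar y <= Phibar x.
Proof. by rewrite le_eqVlt => /predU1P[->//|/Phibar_decr/ltW]. Qed.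

(** * Moving the half-line by an exponential tilt *)

Lemma pih_pih (R : realType) (h h' : R) (f : R -> R) : h <= h' ->
  pih h (pih h' f) = pih h' f.
Proof.
move=> hh'; apply/funext => a; rewrite !pihE.
by case: ifPn => //; case: ifPn => // /(le_trans hh') ->.
Qed.

Section conjugation.
Context (R : realType) (s rho c : R).
Hypotheses (s0 : s != 0) (c0 : 0 < c) (rc : rho ^+ 2 + c ^+ 2 = 1).
Hypotheses (rho_ge0 : 0 <= rho) (rho_lt1 : rho < 1).
Local Notation gam := (normal_prob 0 s).
Local Notation U := (mehler s rho c).

(** The exponent produced by moving the half-line [[h, oo)] to [[0, oo)]; it
is [(d-1)^2 / (2 d)] for the parameters of the tree. *)
Definition tilt_rate : R := (1 - rho) / (2 * s ^+ 2 * (1 + rho)).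

(** The square root of the Cameron-Martin density of the shift by [h]. *)
Definition half_weight (h a : R) : R :=
  expR (- (2 * h * a + h ^+ 2) / (4 * s ^+ 2)).

(** The unitary translation of [f] by [h], damped by the exponential factor
that [mehler_tilt] assigns to the inner side of the operator. *)
Definition tilt (h : R) (f : R -> R) (t : R) : R :=
  f (h + t) * (half_weight h t * expR (- (tilt_rate * h * t))).

Lemma tilt_rate_ge0 : 0 <= tilt_rate.
Proof.
apply: divr_ge0; first by rewrite subr_ge0 ltW.
by apply: mulr_ge0; rewrite ?addr_ge0// mulr_ge0 ?sqr_ge0.
Qed.

Lemma half_weight_sqr h a : half_weight h a ^+ 2 = shift_weight s h a.
Proof.
rewrite /half_weight /shift_weight expr2 -expRD; congr expR.
by field.
Qed.

Lemma measurable_half_weight h : measurable_fun setT (half_weight h).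
Proof.
apply: measurableT_comp => //; apply: measurable_funM => //.
by apply: measurableT_comp => //; apply: measurable_funD.
Qed.

Lemma measurable_tilt h (f : R -> R) :
  measurable_fun setT f -> measurable_fun setT (tilt h f).
Proof.
move=> mf; apply: measurable_funM.
  by apply: (measurableT_comp mf); exact: measurable_funD.
apply: measurable_funM; first exact: measurable_half_weight.
apply: measurableT_comp => //; apply: measurableT_comp => //.
Qed.

(** Write both points of the kernel as [h + a] and [h + t].  The
Cameron-Martin formula absorbs the part of [h] not produced by the
contraction [rho], through the shift [m = h (1 - rho) / c] of the noise.  The
resulting exponent, linear in [a] and [t], is symmetric in them, which leaves
the same factor [exp (- tilt_rate h _)] on either side. *)
Lemma mehler_tilt h (f : R -> R) a : measurable_fun setT f ->
  half_weight h a * U (pih h f) (h + a) =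
  expR (- (tilt_rate * h ^+ 2)) * (expR (- (tilt_rate * h * a)) *
    U (pih 0 (tilt h f)) a).
Proof.
move=> mf; pose m := h * (1 - rho) / c.
have mfh : measurable_fun setT (pih h f) := measurable_pih h mf.
have mF : measurable_fun setT (pih 0 (tilt h f)).
  by apply: measurable_pih; exact: measurable_tilt.
rewrite mulrA -expRD.
rewrite /mehler -[in RHS]RintegralZl_gt0 ?expR_gt0//; last first.
  exact: (measurableT_comp mF (measurable_affine _ _)).
rewrite [X in _ * X = _](_ : _ = Rintegral gam setT (fun y =>
    pih h f ((h + a) * rho + c * (m + y)) * shift_weight s m y)); last first.
  rewrite /Rintegral (integral_normal_shift m s0)//.
  exact: (measurableT_comp mfh (measurable_affine _ _)).
rewrite -RintegralZl_gt0 ?expR_gt0//; last first.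
  apply: measurable_funM; last exact: measurable_shift_weight.
  apply: (measurableT_comp mfh); apply: measurable_funD => //.
  by apply: measurable_funM => //; exact: measurable_funD.
apply: eq_Rintegral => y _.
have -> : (h + a) * rho + c * (m + y) = h + (a * rho + c * y).
  by rewrite /m; field; rewrite gt_eqF.
rewrite !pihE lerDl; case: ifP => _; last by rewrite mul0r !mulr0.
rewrite mulrCA /tilt [RHS]mulrCA; congr (_ * _).
rewrite /half_weight /shift_weight -!expRD; congr expR.
have c2 : c ^+ 2 = (1 - rho) * (1 + rho) by rewrite -subr_sqr expr1n -rc; ring.
have r1 : 1 - rho != 0 by rewrite subr_eq0 gt_eqF.
have r2 : 1 + rho != 0 by rewrite gt_eqF// ltr_wpDr.
rewrite /m /tilt_rate.
apply/eqP; rewrite -subr_eq0; apply/eqP.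
(* The two exponents differ by a multiple of [c^2 - (1 - rho^2)]. *)
transitivity ((c ^+ 2 - (1 - rho) * (1 + rho)) *
  (h * (1 - rho) * (2 * y * c + h * (1 - rho)) /
     (2 * s ^+ 2 * c ^+ 2 * (1 - rho) * (1 + rho)))).
  by field; rewrite s0 r1 r2 gt_eqF.
by rewrite c2 subrr mul0r.
Qed.

Lemma sqnorm_tilt h (f : R -> R) : 0 <= h -> measurable_fun setT f ->
  (sqnorm gam (pih 0 (tilt h f)) <= sqnorm gam f)%E.
Proof.
move=> h0 mf.
have mf2 : measurable_fun setT (fun x => (f x ^+ 2)%:E).
  by apply/measurable_EFinP; exact: measurable_funX.
rewrite [leRHS](ge0_integral_normal_shift h s0)//; last first.
  by move=> x; rewrite lee_fin sqr_ge0.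
apply: ge0_le_integral => //.
- by move=> x _; rewrite lee_fin sqr_ge0.
- apply/measurable_EFinP; apply: measurable_funX; apply: measurable_pih.
  exact: measurable_tilt.
- apply: emeasurable_funM.
    by apply: (measurableT_comp mf2); exact: measurable_funD.
  by apply/measurable_EFinP; exact: measurable_shift_weight.
move=> t _; rewrite -EFinM lee_fin pihE; case: ifPn => [t0|_]; last first.
  by rewrite expr0n/= mulr_ge0 ?sqr_ge0 ?expR_ge0.
rewrite /tilt !exprMn half_weight_sqr ler_wpM2l ?sqr_ge0//.
rewrite ler_piMr ?expR_ge0// expr_le1 ?expR_ge0// -expR0 ler_expR.
by rewrite oppr_le0; do 2 apply: mulr_ge0 => //; exact: tilt_rate_ge0.
Qed.

Lemma sqnorm_mehler_tilt h (f : R -> R) : 0 <= h -> measurable_fun setT f ->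
  (sqnorm gam (pih h (U (pih h f))) <=
   (expR (- (tilt_rate * h ^+ 2)) ^+ 2)%:E *
     sqnorm gam (pih 0 (U (pih 0 (tilt h f)))))%E.
Proof.
move=> h0 mf.
have mfh : measurable_fun setT (pih h (U (pih h f))).
  by apply: measurable_pih; apply: measurable_mehler; exact: measurable_pih.
have mG : measurable_fun setT (pih 0 (U (pih 0 (tilt h f)))).
  apply: measurable_pih; apply: measurable_mehler; apply: measurable_pih.
  exact: measurable_tilt.
have mf2 : measurable_fun setT (fun x => (pih h (U (pih h f)) x ^+ 2)%:E).
  by apply/measurable_EFinP; exact: measurable_funX.
rewrite [leLHS](ge0_integral_normal_shift h s0)//; last first.
  by move=> x; rewrite lee_fin sqr_ge0.
have mG2 : measurable_fun setT
    (fun x => (pih 0 (U (pih 0 (tilt h f))) x ^+ 2)%:E).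
  by apply/measurable_EFinP; exact: measurable_funX.
have G20 x : (0 <= (pih 0 (U (pih 0 (tilt h f))) x ^+ 2)%:E)%E.
  by rewrite lee_fin sqr_ge0.
rewrite -ge0_integralZl// ?lee_fin ?sqr_ge0//.
apply: ge0_le_integral => //.
- by move=> x _; rewrite mule_ge0// lee_fin ?sqr_ge0 ?expR_ge0.
- apply: emeasurable_funM.
    by apply: (measurableT_comp mf2); exact: measurable_funD.
  by apply/measurable_EFinP; exact: measurable_shift_weight.
- apply/measurable_EFinP; apply: measurable_funM => //.
  exact: measurable_funX.
move=> a _; rewrite -!EFinM lee_fin !pihE lerDl.
case: ifPn => [a0|_]; last by rewrite expr0n/= mul0r mulr0.
rewrite -half_weight_sqr -!exprMn mulrC mehler_tilt// !exprMn.
rewrite ler_wpM2l ?sqr_ge0// ler_piMl ?sqr_ge0//.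
rewrite expr_le1 ?expR_ge0// -expR0 ler_expR.
by rewrite oppr_le0; do 2 apply: mulr_ge0 => //; exact: tilt_rate_ge0.
Qed.

End conjugation.

(** * A weight contracted on the positive half-line *)

Section weight.
Context (R : realType) (s rho c : R).
Hypotheses (s0 : 0 < s) (c0 : 0 < c) (rho_ge0 : 0 <= rho) (rho_lt1 : rho < 1).
Local Notation gam := (normal_prob 0 s).

Lemma integral_pih1 (h a : R) :
  (\int[gam]_y (pih h (cst 1%R) (a * rho + c * y))%:E =
   (Phibar ((h - a * rho) / (c * s)))%:E)%E.
Proof.
rewrite invfM mulrA -normal_prob_tail//.
transitivity (\int[gam]_y
    (\1_(`[((h - a * rho) / c)%R, +oo[%classic : set R) y)%:E)%E.
  apply: eq_integral => y _; congr EFin.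
  rewrite pihE indic_geE ler_pdivrMr// lerBlDl (mulrC y).
  by case: ifP.
by rewrite integral_indic// setIT.
Qed.

(** The weight is [w x = K + exp x].  The image of [w] at [a] is at most
[K q(a) + exp (a rho + k)], where [q(a)] is the probability that
[a rho + c Y >= 0].  Up to [A] the loss [1 - q(a)] is at least [1 - p > 0] and
a large [K] makes it beat the exponential term; beyond [A] that term is at
most half of [exp a], and the gain pays for a small multiple of [K]. *)
Lemma normal_contraction_weight : exists (w : R -> R) (mu : R),
  [/\ measurable_fun setT w, forall x, 0 < w x, 0 <= mu, mu < 1 &
    forall a, 0 <= a ->
      (\int[gam]_y (pih 0 w (a * rho + c * y))%:E <= (mu * w a)%:E)%E].
Proof.
pose k := c ^+ 2 * s ^+ 2 / 2.
have k0 : 0 <= k by rewrite divr_ge0// mulr_ge0 ?sqr_ge0.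
(* Past [A] one has [a rho + k + 1 <= a], and [2 <= exp 1]. *)
pose A := (k + 1) / (1 - rho).
pose p := Phibar ((0 - A * rho) / (c * s)).
have p1 : p < 1 by exact: Phibar_lt1.
pose B := expR (A * rho + k).
have B0 : 0 < B by exact: expR_gt0.
(* With this [K], half of the loss [K (1 - p)] covers the exponential term
   [B]; the other half leaves room for [e]. *)
pose K := 2 * B / (1 - p).
have K0 : 0 < K by rewrite divr_gt0 ?mulr_gt0// subr_gt0.
pose e := Num.min ((1 - p) / 2) (Num.min (1 / 4) (1 / (4 * K))).
have e0 : 0 < e.
  rewrite !lt_min; apply/and3P; split; [lra|lra|].
  by rewrite divr_gt0// mulr_gt0.
have [ep e4 eK] : [/\ e <= (1 - p) / 2, e <= 1 / 4 & e * K <= 1 / 4].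
  rewrite /e; split; [by rewrite ge_min lexx|by rewrite !ge_min lexx orbT|].
  rewrite -ler_pdivlMr// !ge_min; apply/orP; right; apply/orP; right.
  by rewrite invfM mulrA.
pose w x := K + expR x.
have w0 x : 0 < w x by rewrite addr_gt0// expR_gt0.
have mw : measurable_fun setT w by apply: measurable_funD.
exists w, (1 - e); split => //; [lra|lra|] => a a0.
pose q := Phibar ((0 - a * rho) / (c * s)).
have mexp : measurable_fun setT (fun y => (expR (c * y))%:E).
  apply/measurable_EFinP; apply: measurableT_comp => //; exact: measurable_funM.
have mp1 : measurable_fun setT
    (fun y => (pih 0 (cst 1%R) (a * rho + c * y))%:E).
  apply/measurable_EFinP.
  by apply: (measurableT_comp (measurable_pih 0 _) (measurable_affine _ _)).
have p10 (y : R) : (0 <= (pih 0 (cst 1%R) (a * rho + c * y))%:E)%E.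
  by rewrite lee_fin pih_ge0.
have bound : (\int[gam]_y (pih 0 w (a * rho + c * y))%:E <=
    (K * q + expR (a * rho + k))%:E)%E.
  rewrite EFinD EFinM -integral_pih1 expRD (EFinM (expR _)).
  have -> : k = c ^+ 2 * s ^+ 2 / 2 by [].
  rewrite -(normal_mgf c (lt0r_neq0 s0)).
  have K0w := ltW K0; rewrite -ge0_integralZl// ?lee_fin//.
  rewrite -ge0_integralZl// ?lee_fin ?expR_ge0//.
  have Kp0 y : (0 <= K%:E * (pih 0 (cst 1%R) (a * rho + c * y))%:E)%E.
    by rewrite mule_ge0// lee_fin ltW.
  have Ee0 y : (0 <= (expR (a * rho))%:E * (expR (c * y))%:E)%E.
    by rewrite mule_ge0// lee_fin expR_ge0.
  have mKp := emeasurable_funM (measurable_cst K%:E) mp1.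
  have mEe := emeasurable_funM (measurable_cst (expR (a * rho))%:E) mexp.
  rewrite -ge0_integralD//.
  apply: ge0_le_integral => //.
  - by move=> y _; rewrite lee_fin pih_ge0// => x; exact: ltW.
  - apply/measurable_EFinP.
    exact: (measurableT_comp (measurable_pih 0 mw) (measurable_affine _ _)).
  - exact: emeasurable_funD.
  move=> y _; rewrite -!EFinM -EFinD lee_fin !pihE; case: ifP => _.
    by rewrite mulr1 -expRD.
  by rewrite mulr0 add0r mulr_ge0 ?expR_ge0.
apply: le_trans bound _; rewrite lee_fin.
have cs0 : 0 < c * s by rewrite mulr_gt0.
have ea : 1 <= expR a by rewrite -expR0 ler_expR.
have [aA|Aa] := leP a A.
  have qp : q <= p.
    apply: Phibar_nincr; rewrite ler_pM2r ?invr_gt0// !sub0r lerN2.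
    by rewrite ler_wpM2r.
  have eB : expR (a * rho + k) <= B by rewrite ler_expR lerD2r ler_wpM2r.
  have KB : K * (1 - p) = 2 * B by rewrite divfK// gt_eqF// subr_gt0.
  rewrite /w.
  have : K * q <= K * p by rewrite ler_wpM2l// ltW.
  have : K * e <= K * ((1 - p) / 2) by rewrite ler_wpM2l// ltW.
  have : 0 <= (1 - e) * expR a by rewrite mulr_ge0 ?expR_ge0//; lra.
  nra.
have q1 : q <= 1 by exact: Phibar_le1.
have eA : 2 * expR (a * rho + k) <= expR a.
  apply: le_trans (_ : expR 1 * expR (a * rho + k) <= _).
    by rewrite ler_wpM2r ?expR_ge0//; have := expR_ge1Dx (1 : R); lra.
  rewrite -expRD ler_expR.
  have : k + 1 <= a * (1 - rho) by rewrite -ler_pdivrMr ?subr_gt0// ltW.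
  lra.
have : K * q <= K by rewrite ler_piMr// ltW.
rewrite /w; nra.
Qed.

End weight.

(** * The operator norm as a function of the level *)

Section lambda.
Context (R : realType) (d : nat).
Hypothesis d_ge2 : (2 <= d)%N.
Local Notation D := (d%:R : R).
Local Notation s := (sigma R d).
Local Notation rho := (D^-1).
Local Notation c := (Num.sqrt (1 - (D ^+ 2)^-1)).
Local Notation gam := (normal_prob 0 s).

Lemma dR_ge2 : 2 <= D.
Proof. by rewrite ler_nat. Qed.

Let D0 : 0 < D. Proof. by have := dR_ge2; lra. Qed.
Let D2 : 1 < D ^+ 2. Proof. by have := dR_ge2; nra. Qed.

Lemma sigma_gt0 : 0 < s.
Proof. by rewrite sqrtr_gt0 divr_gt0// subr_gt0. Qed.

Lemma sigma_sqr : s ^+ 2 = D / (D ^+ 2 - 1).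
Proof. by rewrite sqr_sqrtr// divr_ge0 ?ltW// subr_gt0. Qed.

Lemma noise_gt0 : 0 < c.
Proof. by rewrite sqrtr_gt0 subr_gt0 invf_lt1// (lt_trans ltr01). Qed.

Lemma rho_noise : rho ^+ 2 + c ^+ 2 = 1.
Proof.
rewrite sqr_sqrtr ?exprVn ?subrKC// subr_ge0 invf_le1 ?ltW//.
exact: lt_trans D2.
Qed.

Lemma rho_ge0 : 0 <= rho.
Proof. by rewrite invr_ge0 ltW. Qed.

Lemma rho_lt1 : rho < 1.
Proof. by rewrite invf_lt1//; have := dR_ge2; lra. Qed.

Lemma noise_sigma : c * s = (Num.sqrt D)^-1.
Proof.
rewrite /sigma -sqrtrM; last first.
  by rewrite subr_ge0 invf_le1 ?ltW// (lt_trans ltr01).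
rewrite -(sqrtrV (ltW D0)); congr (Num.sqrt _); field.
by rewrite !gt_eqF// ?subr_gt0.
Qed.

Lemma tilt_rateE : tilt_rate s rho = (D - 1) ^+ 2 / (2 * D).
Proof.
rewrite /tilt_rate sigma_sqr; field.
have := dR_ge2; move=> D2'; rewrite !gt_eqF ?subr_gt0//; lra.
Qed.

(** All estimates on [L_h] go through this form, a multiple of the Mehler
operator between two cuts. *)
Lemma LhE h (f : R -> R) :
  Lh d h f = (fun a => D * pih h (mehler s rho c (pih h f)) a).
Proof.
by apply/funext => a; rewrite /Lh /pih /Lop mulrCA.
Qed.

Lemma measurable_pih_mehler h (f : R -> R) : measurable_fun setT f ->
  measurable_fun setT (pih h (mehler s rho c (pih h f))).
Proof.
move=> mf; apply: measurable_pih; apply: measurable_mehler.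
exact: measurable_pih.
Qed.

Lemma measurable_Lh h (f : R -> R) : measurable_fun setT f ->
  measurable_fun setT (Lh d h f).
Proof.
move=> mf; rewrite LhE; apply: measurable_funM => //.
exact: measurable_pih_mehler.
Qed.

Lemma LhZ h (k : R) (f : R -> R) : 0 < k -> measurable_fun setT f ->
  Lh d h (fun x => k * f x) = (fun x => k * Lh d h f x).
Proof.
move=> k0 mf; rewrite !LhE; apply/funext => a.
have -> : pih h (fun x => k * f x) = (fun x => k * pih h f x).
  by apply/funext => x; rewrite /pih mulrCA.
rewrite mehlerZ//; last exact: measurable_pih.
by rewrite /pih; ring.
Qed.

Lemma sqnorm_Lh h (f : R -> R) : measurable_fun setT f ->
  sqnorm gam (Lh d h f) =
  ((D ^+ 2)%:E * sqnorm gam (pih h (mehler s rho c (pih h f))))%E.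
Proof.
by move=> mf; rewrite LhE sqnorm_scale//; exact: measurable_pih_mehler.
Qed.

Lemma Lh_bound_weight h (w : R -> R) mu :
  measurable_fun setT w -> (forall x, 0 < w x) -> 0 <= mu ->
  (forall a, h <= a ->
     (\int[gam]_y (pih h w (a * rho + c * y))%:E <= (mu * w a)%:E)%E) ->
  sqnorm_bound (nu R d) (Lh d h) (D * mu).
Proof.
move=> mw w0 mu0 hw f mf _.
rewrite /nu sqnorm_Lh// exprMn (EFinM (_ ^+ 2) (mu ^+ 2)) -muleA.
apply: lee_wpmul2l; first by rewrite lee_fin sqr_ge0.
apply: (schur_test _ noise_gt0 rho_noise mw w0 mu0 hw mf).
by rewrite gt_eqF ?sigma_gt0.
Qed.

Lemma Lh_bounded h : sqnorm_bound (nu R d) (Lh d h) D.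
Proof.
rewrite -[X in sqnorm_bound _ _ X]mulr1.
apply: (@Lh_bound_weight h (cst 1)) => // a ha.
by rewrite (integral_pih1 _ sigma_gt0 noise_gt0) lee_fin mulr1 Phibar_le1.
Qed.

Lemma lambda_bound h : sqnorm_bound (nu R d) (Lh d h) (lambda d h).
Proof.
apply: (sqnorm_le_opnorm2 (ltW D0) (@Lh_bounded h)).
- by move=> k g k0 mg; exact: LhZ.
- by move=> f mf; exact: measurable_Lh.
Qed.

Lemma lambda_ge0 h : 0 <= lambda d h :> R.
Proof.
have Lc := @norm2_le_opnorm2 _ (nu R d) (Lh d h) _ (cst 1) (ltW D0)
  (@Lh_bounded h)
  (fun k g k0 mg => @LhZ h k g k0 mg) (measurable_cst _)
  (@measurable_Lh h _ (measurable_cst _)).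
have n1 : sqnorm (nu R d) (cst 1) = 1%E.
  rewrite /sqnorm; under eq_integral do rewrite /cst expr1n.
  by rewrite integral_cst// mul1e; exact: (probability_setT (nu R d)).
have n2 : norm2 (nu R d) (cst 1) = 1 by rewrite norm2E n1 sqrtr1.
have := Lc; rewrite n1 n2 mulr1 => /(_ (ltry _)).
by apply: le_trans; exact: norm2_ge0.
Qed.

(** [L_h'] is [L_h] between two further cuts to [[h', oo)]. *)
Lemma lambda_nincr h h' : h <= h' -> lambda d h' <= lambda d h :> R.
Proof.
move=> hh'; apply: opnorm2_le; first exact: lambda_ge0.
move=> f mf ff.
have mg := measurable_pih h' mf.
have gf : (sqnorm (nu R d) (pih h' f) <= sqnorm (nu R d) f)%E.
  exact: (sqnorm_pih_le (nu R d)).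
apply: (@le_trans _ _ (sqnorm (nu R d) (Lh d h (pih h' f)))).
  rewrite /nu (sqnorm_Lh h' mf) (sqnorm_Lh h mg).
  apply: lee_wpmul2l; first by rewrite lee_fin sqr_ge0.
  rewrite pih_pih//; set g := mehler _ _ _ _.
  rewrite (_ : pih h' g = pih h' (pih h g)).
    apply: sqnorm_pih_le; apply: measurable_pih; exact: measurable_mehler.
  apply/funext => a; rewrite !pihE; case: ifPn => // ha.
  by rewrite (le_trans hh' ha).
apply: le_trans (lambda_bound _ mg (le_lt_trans gf ff)) _.
by apply: lee_wpmul2l => //; rewrite lee_fin sqr_ge0.
Qed.

Lemma lambda0_lt_d : lambda d 0 < D.
Proof.
have [w [mu [mw w0 mu0 mu1 hw]]] :=
  normal_contraction_weight sigma_gt0 noise_gt0 rho_ge0 rho_lt1.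
apply: (@le_lt_trans _ _ (D * mu)); last by rewrite gtr_pMr.
apply: opnorm2_le; first by rewrite mulr_ge0// ltW.
exact: Lh_bound_weight mw w0 mu0 hw.
Qed.

(** Tilting carries [f] to a function of no larger norm, on which [L_0] acts
with norm [lambda d 0]. *)
Lemma lambda_tilt_le h : 0 <= h ->
  lambda d h <= lambda d 0 * expR (- (tilt_rate s rho * h ^+ 2)).
Proof.
move=> h0; have s0 : s != 0 by rewrite gt_eqF ?sigma_gt0.
apply: opnorm2_le.
  by rewrite mulr_ge0 ?lambda_ge0 ?expR_ge0.
move=> f mf ff; pose G := pih 0 (tilt s rho h f).
have mG : measurable_fun setT G.
  by apply: measurable_pih; exact: measurable_tilt.
have Gf : (sqnorm (nu R d) G <= sqnorm (nu R d) f)%E.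
  exact: (sqnorm_tilt s0 rho_ge0 rho_lt1).
apply: (@le_trans _ _ ((expR (- (tilt_rate s rho * h ^+ 2)) ^+ 2)%:E *
    sqnorm (nu R d) (Lh d 0 G))%E).
  rewrite /nu !sqnorm_Lh// muleCA; apply: lee_wpmul2l.
    by rewrite lee_fin sqr_ge0.
  rewrite /G pih_pih//.
  exact: (sqnorm_mehler_tilt s0 noise_gt0 rho_noise rho_ge0 rho_lt1 h0 mf).
rewrite (mulrC (lambda d 0)) exprMn (EFinM (expR _ ^+ 2)) -muleA.
apply: lee_wpmul2l.
  by rewrite lee_fin sqr_ge0.
apply: le_trans (lambda_bound _ mG (le_lt_trans Gf ff)) _.
by apply: lee_wpmul2l => //; rewrite lee_fin sqr_ge0.
Qed.

(** Test on the indicator [e] of [[h, oo)].  The hypothesis says that [L_h e]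
is at least [1] on [[h, oo)]; being increasing there, it stays above some
[q > 1] past [h + 1], a set of positive mass. *)
Lemma lambda_gt1 h : 1 <= D * Phibar (h * ((D - 1) / Num.sqrt D)) ->
  1 < lambda d h :> R.
Proof.
move=> h1.
pose Q a : R := D * Phibar ((h - a * rho) / (c * s)).
have cs0 : 0 < c * s by rewrite mulr_gt0 ?noise_gt0 ?sigma_gt0.
have Qh : 1 <= Q h.
  rewrite /Q (_ : (h - h * rho) / (c * s) = h * ((D - 1) / Num.sqrt D))//.
  rewrite noise_sigma invrK.
  have r0 : Num.sqrt D != 0 by rewrite gt_eqF// sqrtr_gt0.
  move: (sqr_sqrtr (ltW D0)) r0; set r := Num.sqrt D; clearbody r => <- r0.
  by field.
have Qlt a b : a < b -> Q a < Q b.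
  move=> ab; rewrite ltr_pM2l// Phibar_decr// ltr_pM2r ?invr_gt0//.
  by rewrite ltrD2l ltrN2 ltr_pM2r// invr_gt0.
pose q := Q (h + 1).
have q1 : 1 < q by apply: le_lt_trans Qh _; apply: Qlt; rewrite ltrDl.
pose e : R -> R := pih h (cst 1).
have me : measurable_fun setT e by apply: measurable_pih; exact: measurable_cst.
have Le a : Lh d h e a = if h <= a then Q a else 0.
  rewrite LhE /e pih_pih// pihE; case: ifP => _; last by rewrite mulr0.
  by rewrite /Q /mehler /Rintegral (integral_pih1 _ sigma_gt0 noise_gt0).
have tail x : 0 < Phibar (x / s) by exact: Phibar_gt0.
have sqe x : (\int[gam]_a (pih x (cst 1%R) a)%:E = (Phibar (x / s))%:E)%E.
  rewrite -normal_prob_tail ?sigma_gt0//.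
  transitivity (\int[gam]_y (\1_(`[x, +oo[%classic : set R) y)%:E)%E.
    by apply: eq_integral => y _; rewrite pihE indic_geE; case: ifP.
  by rewrite integral_indic// setIT.
have ne : sqnorm gam e = (Phibar (h / s))%:E.
  rewrite -sqe; apply: eq_integral => a _; rewrite /e pihE.
  by case: ifP; rewrite ?expr1n ?expr0n.
have low : ((Phibar (h / s) + (q ^+ 2 - 1) * Phibar ((h + 1) / s))%:E <=
    sqnorm gam (Lh d h e))%E.
  have mi x : measurable_fun setT (fun a : R => (pih x (cst 1%R) a)%:E).
    by apply/measurable_EFinP; apply: measurable_pih; exact: measurable_cst.
  have i0 x (a : R) : (0 <= (pih x (cst 1%R) a)%:E)%E.
    by rewrite lee_fin pih_ge0.
  have mih := mi h; have mih1 := mi (h + 1).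
  have q0 : 0 <= q ^+ 2 - 1 by nra.
  have mk := emeasurable_funM (measurable_cst (q ^+ 2 - 1)%:E) (mi (h + 1)).
  have k0 a : (0 <= (q ^+ 2 - 1)%:E * (pih (h + 1) (cst 1%R) a)%:E)%E.
    by rewrite mule_ge0// lee_fin.
  rewrite EFinD (EFinM (q ^+ 2 - 1)) -!sqe -ge0_integralZl// ?lee_fin//.
  rewrite -ge0_integralD//.
  apply: ge0_le_integral => //.
  - by move=> a _; rewrite adde_ge0.
  - exact: emeasurable_funD (mi h) mk.
  - by apply/measurable_EFinP; apply: measurable_funX; exact: measurable_Lh.
  move=> a _; rewrite -EFinM -EFinD lee_fin Le !pihE.
  have [ha|ha] := leP (h + 1) a.
    have -> : h <= a by lra.
    have : q <= Q a.
      by move: ha; rewrite le_eqVlt => /predU1P[<-//|/Qlt/ltW].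
    rewrite /cst; nra.
  case: (leP h a) => h2; last by rewrite mulr0 addr0 expr0n.
  have : Q h <= Q a.
    by move: h2; rewrite le_eqVlt => /predU1P[<-//|/Qlt/ltW].
  rewrite /cst mulr0 addr0; nra.
have ef : (sqnorm (nu R d) e < +oo)%E by rewrite /nu ne ltry.
have := le_trans low (@lambda_bound h e me ef).
rewrite /nu ne -EFinM lee_fin.
have := tail h; have := tail (h + 1); have := @lambda_ge0 h.
set l := lambda d h; set y := Phibar _; set x := Phibar _ => l0 y0 x0 H.
rewrite ltNge; apply/negP => l1.
have : 0 < (q ^+ 2 - 1) * y by rewrite mulr_gt0//; nra.
have : l ^+ 2 * x <= x by apply: ler_piMl; [exact: ltW|rewrite expr_le1].
lra.
Qed.
End lambda.

(** With [g = (d-1)^2 / (2 d)], the equations for [hsquare] and [ustar] give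
[exp (- g hsquare^2) = 1 / lambda 0] and [exp (- g (2 ustar)) = 1 / d]; the
bounds [lambda_tilt_le] and [lambda0_lt_d] compare them. *)
Lemma critical_level_bounds (R : realType) (d : nat)
    (hstar ustar hDelta hsquare : R) : (2 <= d)%N ->
  lambda d hstar = 1 ->
  d%:R * expR (- (ustar * ((d%:R - 1) ^+ 2 / d%:R))) = 1 ->
  d%:R * Phibar (hDelta * ((d%:R - 1) / Num.sqrt d%:R)) = 1 ->
  0 <= hsquare ->
  lambda d (0 : R) *
    expR (- (hsquare ^+ 2 * (d%:R - 1) ^+ 2 / (2 * d%:R))) = 1 ->
  [/\ 0 <= hDelta, hDelta < hstar, hstar <= hsquare
    & hsquare < Num.sqrt (2 * ustar)].
Proof.
move=> d_ge2.
have D2 : 2 <= d%:R :> R by rewrite ler_nat.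
have D0 : 0 < d%:R :> R by lra.
have D1 : 0 < d%:R - 1 :> R by lra.
(* Comparing with [1/2] suffices, as [d >= 2]. *)
have Dhalf (p : R) : 2^-1 < p -> d%:R * p != 1.
  by move=> p2; apply: contraTneq p2 => Dp; rewrite -leNgt; nra.
pose g : R := (d%:R - 1) ^+ 2 / (2 * d%:R).
have g0 : 0 < g by rewrite /g divr_gt0 ?mulr_gt0// exprn_gt0.
move=> hstar_lambda ustar_eq hDelta_eq hsquare_ge0 hsquare_eq.
have hD0 : 0 <= hDelta.
  rewrite leNgt; apply/negP => hD.
  have /Phibar_decr : hDelta * ((d%:R - 1) / Num.sqrt d%:R) < 0.
    by rewrite nmulr_rlt0// divr_gt0// sqrtr_gt0.
  by move=> /(le_lt_trans (Phibar0 R))/Dhalf; rewrite hDelta_eq eqxx.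
have hDs : hDelta < hstar.
  rewrite ltNge; apply/negP => hsD.
  have l1 : 1 < lambda d hDelta by apply: lambda_gt1 => //; rewrite hDelta_eq.
  by have := lambda_nincr d_ge2 hsD; rewrite hstar_lambda leNgt l1.
have lg : lambda d (0 : R) * expR (- (g * hsquare ^+ 2)) = 1.
  by rewrite -[RHS]hsquare_eq; congr (_ * expR (- _)); rewrite /g; ring.
have l0 : 0 < lambda d (0 : R).
  by rewrite -(pmulr_lgt0 _ (expR_gt0 (- (g * hsquare ^+ 2)))) lg.
split => //.
  have hs0 : 0 <= hstar := ltW (le_lt_trans hD0 hDs).
  have := lambda_tilt_le d_ge2 hs0.
  rewrite tilt_rateE// hstar_lambda -/g -lg ler_pM2l//.
  rewrite ler_expR lerN2 ler_pM2l//.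
  by rewrite ler_sqr ?nnegrE.
have lD := lambda0_lt_d R d_ge2.
have ug : d%:R * expR (- (g * (2 * ustar))) = 1 :> R.
  rewrite -[RHS]ustar_eq; congr (_ * expR (- _)); rewrite /g; field.
  by rewrite gt_eqF.
have : expR (- (g * (2 * ustar))) < expR (- (g * hsquare ^+ 2)).
  by rewrite -(ltr_pM2l D0) ug -[ltLHS]lg ltr_pM2r ?expR_gt0.
rewrite ltr_expR ltrN2 ltr_pM2l// => h2.
rewrite -(ger0_norm hsquare_ge0) -sqrtr_sqr ltr_sqrt//.
by rewrite (le_lt_trans _ h2)// sqr_ge0.
Qed.

Theorem corollary4p5 (R : realType) (d : nat) (d_ge2 : (2 <= d)%N)
  (T : eqType) (nb : T -> seq T) (tree : regular_tree nb d.+1)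
  (dO : measure_display) (Omega : measurableType dO) (P : probability Omega R)
  (phi : T -> {RV P >-> R}) (gff : gaussian_free_field nb phi)
  (hstar : R) (hstar_crit : gff_critical_value nb phi hstar)
  (hstar_lambda : lambda d hstar = 1)
  (dO' : measure_display) (Omega' : measurableType dO')
  (P' : probability Omega' R) (V : R -> Omega' -> set T)
  (vacant : forall u, 0 < u -> interlacement_vacant_set P' nb u (V u))
  (ustar : R) (ustar_crit : vacant_critical_level P' nb V ustar)
  (ustar_eq : d%:R * expR (- (ustar * ((d%:R - 1) ^+ 2 / d%:R))) = 1)
  (hDelta : R)
  (hDelta_eq : d%:R * Phibar (hDelta * ((d%:R - 1) / Num.sqrt d%:R)) = 1)
  (hsquare : R) (hsquare_ge0 : 0 <= hsquare)
  (hsquare_eq : lambda d (0 : R) *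
     expR (- (hsquare ^+ 2 * (d%:R - 1) ^+ 2 / (2 * d%:R))) = 1) :
  [/\ 0 <= hDelta, hDelta < hstar, hstar <= hsquare
    & hsquare < Num.sqrt (2 * ustar)].
Proof.
exact: (critical_level_bounds d_ge2 hstar_lambda ustar_eq hDelta_eq
  hsquare_ge0 hsquare_eq).
Qed.
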